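(* Let $n\ge1$ and let $A\subseteq\omega$ be any set. The following are equivalent: (i) $\{Z\subseteq\omega: Z<_e A\}$ has a unique (up to the order of the ideals) proper covering by $n$ ideals; (ii) $\{Z\subseteq\omega:Z<_e A\}$ has a proper covering by $n$ ideals; (iii) $A$ is $n$-join irreducible and $(n-1)$-join reducible.
   Context: $\le_e$ is enumeration reducibility ($A=\Gamma(B)$ for some c.e. set $\Gamma$ of axioms $\langle x,D\rangle$, $D$ finite); $<_e$, $\equiv_e$ as usual; $X\oplus Y=\{2x:x\in X\}\cup\{2x+1:x\in Y\}$. In this statement sets range over all subsets of $\omega$. An ideal is a nonempty family of sets closed downward under $\le_e$ and closed under $\oplus$. A covering of $\{Z:Z<_e A\}$ by $n$ ideals is a list of ideals $\mathcal F_1,\dots,\mathcal F_n$ with $\bigcup_i\mathcal F_i=\{Z:Z<_e A\}$; it is proper if $\mathcal F_i\not\subseteq\mathcal F_j$ for all $i\ne j$. For $m\ge0$, $A$ is $m$-join irreducible if for all $A_0,\dots,A_m<_e A$ there are $i\ne j$ with $A_i\oplus A_j<_e A$, and $A$ is $m$-join reducible if it is not $m$-join irreducible (i.e. there are $A_0,\dots,A_m<_e A$ with $A_i\oplus A_j\equiv_e A$ for all $i\neq j$). *)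

(* Defs.v *)
From mathcomp Require Import all_boot perm.
From mathcomp Require Import boolp classical_sets.

Set Implicit Arguments.
Unset Strict Implicit.
Unset Printing Implicit Defensive.

Local Open Scope classical_set_scope.

(* [recfun k]: Kleene schemes for the k-ary partial recursive functions. *)
Inductive recfun : nat -> Type :=
| RZero : recfun 0
| RSucc : recfun 1
| RProj k (i : 'I_k) : recfun k
| RComp k m (f : recfun m) (g : 'I_m -> recfun k) : recfun k
| RPrec k (f : recfun k) (g : recfun k.+2) : recfun k.+1
| RMu k (f : recfun k.+1) : recfun k.

(* [prec_graph F G v n y]: the partial function h defined by h(0, v) = F(v) and
   h(n+1, v) = G(n, h(n, v), v) is defined at (n, v) with value y, where F and
   G are given by their graphs. *)
Fixpoint prec_graph k (F : k.-tuple nat -> nat -> Prop)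
    (G : k.+2.-tuple nat -> nat -> Prop) (v : k.-tuple nat) (n y : nat) : Prop :=
  match n with
  | 0 => F v y
  | n'.+1 => exists2 z, prec_graph F G v n' z & G [tuple of n' :: z :: v] y
  end.

(* [eval c v y]: the computation of c on the input v converges with output y.
   Minimization requires convergence at all arguments below the least zero. *)
Fixpoint eval k (c : recfun k) : k.-tuple nat -> nat -> Prop :=
  match c in recfun k return k.-tuple nat -> nat -> Prop with
  | RZero => fun _ y => y = 0
  | RSucc => fun v y => y = (thead v).+1
  | RProj _ i => fun v y => y = tnth v i
  | RComp _ m f g => fun v y =>
      exists2 w : m.-tuple nat, forall i, eval (g i) v (tnth w i) & eval f w y
  | RPrec _ f g => fun v y =>
      prec_graph (eval f) (eval g) [tuple of behead v] (thead v) y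
  | RMu _ f => fun v y =>
      eval f [tuple of y :: v] 0 /\
      forall z, z < y -> exists u, eval f [tuple of z :: v] u.+1
  end.

Definition computable (f : nat -> nat) : Prop :=
  exists c : recfun 1, forall x y, eval c [tuple x] y <-> y = f x.

Definition ce (W : set nat) : Prop :=
  W = set0 \/ exists2 f : nat -> nat, computable f & W = range f.

(* Cantor's pairing bijection. *)
Definition npair (x y : nat) : nat := ((x + y) * (x + y).+1)./2 + y.

(* The finite set with canonical index u, i.e. u is the sum of 2 ^ y over its
   elements y. *)
Definition canon (u : nat) : set nat := [set y | odd (u %/ 2 ^ y)].

(* The set enumerated from B by the set of axioms coded by Gamma: the number
   npair x u codes the axiom <x, canon u>. *)
Definition enum_op (Gamma B : set nat) : set nat :=
  [set x | exists2 u, Gamma (npair x u) & canon u `<=` B].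

Definition ele (A B : set nat) : Prop :=
  exists2 Gamma, ce Gamma & A = enum_op Gamma B.

Definition elt (A B : set nat) : Prop := ele A B /\ ~ ele B A.

Definition ejoin (X Y : set nat) : set nat :=
  [set x.*2 | x in X] `|` [set x.*2.+1 | x in Y].

Definition eideal (J : set (set nat)) : Prop :=
  [/\ J !=set0,
      forall X Y, ele X Y -> J Y -> J X &
      forall X Y, J X -> J Y -> J (ejoin X Y)].

Definition ebelow (A : set nat) : set (set nat) := [set Z | elt Z A].

Definition covering (n : nat) (S : set (set nat))
    (F : 'I_n -> set (set nat)) : Prop :=
  (forall i, eideal (F i)) /\ \bigcup_i F i = S.

Definition proper_covering (n : nat) (S : set (set nat))
    (F : 'I_n -> set (set nat)) : Prop :=
  covering S F /\ forall i j, i != j -> ~ (F i `<=` F j).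

Definition join_irreducible (m : nat) (A : set nat) : Prop :=
  forall B : 'I_m.+1 -> set nat, (forall i, elt (B i) A) ->
  exists i j, i != j /\ elt (ejoin (B i) (B j)) A.

Definition join_reducible (m : nat) (A : set nat) : Prop :=
  ~ join_irreducible m A.

(* Main.v *)
Require Import Defs.
From mathcomp Require Import all_boot perm.
From mathcomp Require Import boolp classical_sets.
From mathcomp Require Import zify.

Set Implicit Arguments.
Unset Strict Implicit.
Unset Printing Implicit Defensive.

Local Open Scope classical_set_scope.

(* Enumeration reducibility is a preorder in which the join is a least upper
   bound; the rest is order theory. In a proper covering F_1, ..., F_n, finite
   joins of elements of F_i \ F_j give X_i lying in F_i and in no other ideal,
   so X_i + X_j lies in no ideal for i <> j and has the degree of A, while n+1
   sets below A put two into one ideal. Moreover F_i = {Z | Z + X_i < A}, and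
   a second proper covering must place the X_i in distinct ideals, so it is a
   permutation of the first. Conversely, if A_1, ..., A_n < A join pairwise to
   A, the sets {Z | Z + A_i < A} form a proper covering: n-join irreducibility
   applied to Z, A_1, ..., A_n gives the covering property, and applied to the
   family with A_i replaced by Z + A_i and W + A_i it gives closure under
   joins. *)

(** * Total computable functions *)

(* The environment is an untyped list, of which only the first [k] entries
   matter; this gives de Bruijn-style variables [nth 0 v i] without casts. *)
Definition comput (k : nat) (f : seq nat -> nat) : Prop :=
  exists c : recfun k, forall (v : k.-tuple nat) y, eval c v y <-> y = f v.

Lemma comput_ext k f g :
  (forall v, size v = k -> f v = g v) -> comput k f -> comput k g.
Proof.
move=> fg [c cE]; exists c => v y.
by rewrite cE fg ?size_tuple.
Qed.

Lemma comput_nth k i : i < k -> comput k (fun v => nth 0 v i).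
Proof.
move=> ik; exists (RProj (Ordinal ik)) => v y /=.
by rewrite (tnth_nth 0).
Qed.

Lemma comput_comp k m F (g : nat -> seq nat -> nat) :
  comput m F -> (forall i, i < m -> comput k (g i)) ->
  comput k (fun v => F (mkseq (g^~ v) m)).
Proof.
move=> [c cE] gE.
have /choice[d dE] : forall i : 'I_m, exists d : recfun k,
    forall (v : k.-tuple nat) y, eval d v y <-> y = g i v.
  by move=> i; apply: gE.
exists (RComp c d) => v y /=; split.
  move=> [w wE /cE->]; congr F.
  apply: (@eq_from_nth _ 0) => [|i]; rewrite size_tuple ?size_mkseq// => im.
  rewrite nth_mkseq//.
  by have /dE <- := wE (Ordinal im); rewrite (tnth_nth 0).
move=> ->; exists (mktuple (fun i : 'I_m => g i v)).
  by move=> i; apply/dE; rewrite tnth_mktuple.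
by apply/cE; rewrite /mkseq -val_enum_ord -map_comp.
Qed.

Lemma comput_comp1 h :
  comput 1 (fun v => h (nth 0 v 0)) ->
  forall k f, comput k f -> comput k (fun v => h (f v)).
Proof. by move=> ch k f cf; apply: (comput_comp (g := fun=> f) ch). Qed.

Lemma comput_comp2 h :
  comput 2 (fun v => h (nth 0 v 0) (nth 0 v 1)) ->
  forall k f g, comput k f -> comput k g -> comput k (fun v => h (f v) (g v)).
Proof.
move=> ch k f g cf cg.
by apply: (comput_comp (g := fun i => if i is 0 then f else g) ch) => -[|].
Qed.

Lemma comput_succn k f : comput k f -> comput k (fun v => (f v).+1).
Proof.
apply: (comput_comp1 (h := succn)).
by exists RSucc => v y /=; rewrite /thead (tnth_nth 0).
Qed.

Lemma comput_const n k : comput k (fun=> n).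
Proof.
elim: n => [|n IHn]; last exact: (comput_succn IHn).
have zero0 : comput 0 (fun=> 0) by exists RZero.
by apply: (comput_comp (g := fun _ _ => 0) zero0).
Qed.

(** Parameters of a recursion body sit behind [behead]; the index is shifted instead, and [e] stays
    abstract so that the step can be iterated. *)
Lemma comput_nthS k j (e : seq nat -> seq nat) :
  comput k (fun v => nth 0 (e v) j.+1) ->
  comput k (fun v => nth 0 (behead (e v)) j).
Proof. by apply: comput_ext => v _; rewrite nth_behead. Qed.

(** [RPrec] recurses on its first entry, so the recursor is built on lists [n :: v], and [b v] is
    then substituted for [n]. *)
Lemma comput_rec k b z S :
  comput k b -> comput k z ->
  comput k.+2 (fun w => S (nth 0 w 0) (nth 0 w 1) (behead (behead w))) ->
  comput k (fun v => nat_rect (fun=> nat) (z v) (fun i r => S i r v) (b v)).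
Proof.
move=> cb [cz czE] [cS cSE].
have cr : comput k.+1 (fun w => nat_rect (fun=> nat) (z (behead w))
    (fun i r => S i r (behead w)) (nth 0 w 0)).
  exists (RPrec cz cS) => v y /=.
  have -> : nth 0 v 0 = thead v by rewrite /thead (tnth_nth 0).
  elim: (thead v) y => [|n IHn] y /=; first exact: (czE [tuple of behead v]).
  split; first by move=> [r /IHn <- /cSE].
  by move=> ->; eexists; [exact/IHn | exact/cSE].
pose g i := if i is j.+1 then nth 0 ^~ j else b.
have cg i : i < k.+1 -> comput k (g i).
  by case: i => [|i] //= ik; apply: comput_nth.
apply: comput_ext (comput_comp cr cg) => v sv.
suff -> : mkseq (g ^~ v) k.+1 = b v :: v by [].
apply: (@eq_from_nth _ 0) => [|i]; rewrite size_mkseq /= ?sv// => ik.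
by rewrite nth_mkseq//; case: i ik.
Qed.

Lemma comput_addn k f g :
  comput k f -> comput k g -> comput k (fun v => f v + g v).
Proof.
move=> cf cg; have := @comput_rec k f g (fun _ r _ => r.+1) cf cg.
move/(_ (comput_succn (comput_nth (isT : 1 < k.+2)))); apply: comput_ext => v _.
by elim: (f v) => //= n ->.
Qed.

Lemma comput_muln k f g :
  comput k f -> comput k g -> comput k (fun v => f v * g v).
Proof.
apply: (comput_comp2 (h := muln)).
have := @comput_rec 2 (nth 0 ^~ 0) (fun=> 0) (fun _ r v => nth 0 v 1 + r).
move=> /(_ (comput_nth _) (comput_const _ _) (comput_addn _ (comput_nth _))).
move=> /(_ isT _ isT) H; apply: comput_ext (H _).
  by move=> v _; elim: (nth 0 v 0) => //= n ->; rewrite mulSn.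
by do 2 apply: comput_nthS; apply: comput_nth.
Qed.

Lemma comput_expn b k f : comput k f -> comput k (fun v => b ^ f v).
Proof.
move=> cf; have := @comput_rec k f (fun=> 1) (fun _ r _ => b * r) cf.
move=> /(_ (comput_const _ _) (comput_muln (comput_const _ _) (comput_nth _))).
move=> /(_ isT); apply: comput_ext => v _.
by elim: (f v) => //= n ->; rewrite expnS.
Qed.

Lemma comput_predn k f : comput k f -> comput k (fun v => (f v).-1).
Proof.
move=> cf; have := @comput_rec k f (fun=> 0) (fun i _ _ => i) cf.
move=> /(_ (comput_const _ _) (comput_nth (isT : 0 < k.+2))).
by apply: comput_ext => v _; case: (f v).
Qed.

Lemma comput_subn k f g :
  comput k f -> comput k g -> comput k (fun v => f v - g v).
Proof.
move=> cf cg; have := @comput_rec k g f (fun _ r _ => r.-1) cg cf.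
move/(_ (comput_predn (comput_nth (isT : 1 < k.+2)))); apply: comput_ext => v _.
by elim: (g v) => [|n /= ->]; rewrite ?subn0 ?subnS.
Qed.

Lemma comput_leq k f g :
  comput k f -> comput k g -> comput k (fun v => f v <= g v).
Proof.
move=> cf cg.
(* Booleans count as 0 or 1 and [1 - m] tests [m = 0]; truncated subtraction vanishes exactly when
   [f v <= g v]. *)
apply: comput_ext (comput_subn (comput_const 1 k) (comput_subn cf cg)) => v _.
by rewrite /leq; case: (f v - g v).
Qed.

Lemma comput_andb k (P Q : seq nat -> bool) :
  comput k P -> comput k Q -> comput k (fun v => P v && Q v).
Proof.
move=> cP cQ; apply: comput_ext (comput_muln cP cQ) => v _.
by rewrite mulnb.
Qed.

Lemma comput_negb k (P : seq nat -> bool) :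
  comput k P -> comput k (fun v => ~~ P v).
Proof.
move=> cP; apply: comput_ext (comput_subn (comput_const 1 k) cP) => v _.
by case: (P v).
Qed.

Lemma comput_orb k (P Q : seq nat -> bool) :
  comput k P -> comput k Q -> comput k (fun v => P v || Q v).
Proof.
move=> cP cQ.
apply: comput_ext (comput_negb (comput_andb (comput_negb cP) (comput_negb cQ))).
by move=> v _; rewrite negb_and !negbK.
Qed.

Lemma comput_implyb k (P Q : seq nat -> bool) :
  comput k P -> comput k Q -> comput k (fun v => P v ==> Q v).
Proof.
move=> cP cQ; apply: comput_ext (comput_orb (comput_negb cP) cQ).
by move=> v _; rewrite implybE.
Qed.

Lemma comput_eqn k f g :
  comput k f -> comput k g -> comput k (fun v => f v == g v).
Proof.
move=> cf cg.
apply: comput_ext (comput_andb (comput_leq cf cg) (comput_leq cg cf)) => v _.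
by rewrite -eqn_leq.
Qed.

Lemma comput_if k (P : seq nat -> bool) f g :
  comput k P -> comput k f -> comput k g ->
  comput k (fun v => if P v then f v else g v).
Proof.
move=> cP cf cg.
have := comput_addn (comput_muln cP cf) (comput_muln (comput_negb cP) cg).
apply: comput_ext => v _.
by case: (P v); rewrite ?mul1n ?mul0n ?addn0.
Qed.

Definition exb (n : nat) (P : nat -> bool) : bool := has P (iota 0 n).

Definition allb (n : nat) (P : nat -> bool) : bool := all P (iota 0 n).

Lemma exbP n (P : nat -> bool) : reflect (exists2 i, i < n & P i) (exb n P).
Proof.
apply: (iffP hasP) => -[i]; last by exists i; rewrite ?mem_iota.
by rewrite mem_iota; exists i.
Qed.

Lemma allbP n (P : nat -> bool) : reflect (forall i, i < n -> P i) (allb n P).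
Proof.
apply: (iffP allP) => H i; last by rewrite mem_iota; exact: H.
by move=> ilt; apply: H; rewrite mem_iota.
Qed.

Lemma comput_exb k b (P : nat -> seq nat -> bool) :
  comput k b -> comput k.+1 (fun w => P (nth 0 w 0) (behead w)) ->
  comput k (fun v => exb (b v) (P ^~ v)).
Proof.
move=> cb cP.
have := @comput_rec k b (fun=> 0) (fun i r v => P i v || (0 < r)) cb.
move=> /(_ (comput_const _ _) (comput_orb _ _)) H.
apply: comput_ext (H _ _).
- move=> v _; elim: (b v) => //= n ->.
  by rewrite /exb -[n.+1]addn1 iotaD has_cat /= orbF lt0b orbC.
(* [g] skips entry 1, the truth value accumulated so far, and keeps the counter and the
   parameters. *)
- pose g i := if i is j.+1 then fun w : seq nat => nth 0 w j.+2
              else fun w => nth 0 w 0.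
  have cg i : i < k.+1 -> comput k.+2 (g i) by case: i => [|i] ?; exact: comput_nth.
  apply: comput_ext (comput_comp cP cg) => w sw.
  suff -> : mkseq (g ^~ w) k.+1 = nth 0 w 0 :: behead (behead w) by [].
  apply: (@eq_from_nth _ 0) => [|i]; rewrite size_mkseq /= ?size_behead ?sw// => ik.
  by rewrite nth_mkseq//; case: i ik => //= i _; rewrite !nth_behead.
- by apply: comput_leq; [exact: comput_const | exact: comput_nth].
Qed.

Lemma comput_allb k b (P : nat -> seq nat -> bool) :
  comput k b -> comput k.+1 (fun w => P (nth 0 w 0) (behead w)) ->
  comput k (fun v => allb (b v) (P ^~ v)).
Proof.
move=> cb cP.
have := @comput_exb k b (fun i v => ~~ P i v) cb (comput_negb cP).
move/comput_negb; apply: comput_ext => v _; rewrite /exb /allb has_predC negbK.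
by congr (nat_of_bool _).
Qed.

Lemma comput_odd k f : comput k f -> comput k (fun v => odd (f v)).
Proof.
move=> cf; have := @comput_rec k f (fun=> 0) (fun _ r _ => 1 - r) cf.
move=> /(_ (comput_const _ _) (comput_subn (comput_const _ _) (comput_nth _))).
move=> /(_ isT); apply: comput_ext => v _.
by elim: (f v) => //= n ->; case: (odd n).
Qed.

Lemma comput_half k f : comput k f -> comput k (fun v => (f v)./2).
Proof.
move=> cf; have := @comput_rec k f (fun=> 0) (fun i r _ => odd i + r) cf.
move=> /(_ (comput_const _ _)).
move=> /(_ (comput_addn (comput_odd (comput_nth _)) (comput_nth _)) ).
move=> /(_ isT isT); apply: comput_ext => v _.
by elim: (f v) => //= n ->; rewrite uphalf_half.
Qed.

Lemma comput_double k f : comput k f -> comput k (fun v => (f v).*2).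
Proof.
move=> cf; apply: comput_ext (comput_addn cf cf) => v _.
by rewrite addnn.
Qed.

Lemma comput_npair k f g :
  comput k f -> comput k g -> comput k (fun v => npair (f v) (g v)).
Proof.
move=> cf cg; apply: comput_addn => //; apply: comput_half.
by apply: comput_muln; [|apply: comput_succn]; apply: comput_addn.
Qed.

(* [boolp] also exports a constant named [canon]. *)
Local Notation canon := Defs.canon.

Definition canonb (u y : nat) : bool := odd (u %/ 2 ^ y).

Lemma comput_canonb k f g :
  comput k f -> comput k g -> comput k (fun v => canonb (f v) (g v)).
Proof.
move=> cf cg; apply: comput_odd.
have := @comput_rec k g f (fun _ r _ => r./2) cg cf.
move=> /(_ (comput_half (comput_nth (isT : 1 < k.+2)))); apply: comput_ext => v _.
elim: (g v) => [|n /= ->]; first by rewrite expn0 divn1.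
by rewrite -divn2 -divnMA -expnSr.
Qed.

(** Computability is read off the syntax of the term; the last two cases compose with an abstract
    function or relation whose computability is in the context. *)
Ltac comput_tac := repeat lazymatch goal with
  | |- comput _ (fun v => nth 0 (behead _) _) => apply: comput_nthS
  | |- comput _ (fun v => nth 0 v _) => by apply: comput_nth
  | |- comput _ (fun v => nat_of_bool (@?a v && @?b v)) =>
      apply: (comput_andb (P := a) (Q := b))
  | |- comput _ (fun v => nat_of_bool (@?a v || @?b v)) =>
      apply: (comput_orb (P := a) (Q := b))
  | |- comput _ (fun v => nat_of_bool (@?a v ==> @?b v)) =>
      apply: (comput_implyb (P := a) (Q := b))
  | |- comput _ (fun v => nat_of_bool (@?a v == @?b v)) =>
      apply: (comput_eqn (f := a) (g := b))
  | |- comput _ (fun v => nat_of_bool (canonb (@?a v) (@?b v))) =>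
      apply: (comput_canonb (f := a) (g := b))
  | |- comput _ (fun v => nat_of_bool (exb _ _)) => apply: comput_exb
  | |- comput _ (fun v => nat_of_bool (allb _ _)) => apply: comput_allb
  | |- comput _ (fun v => npair _ _) => apply: comput_npair
  | |- comput _ (fun v => expn _ _) => apply: comput_expn
  | |- comput _ (fun v => double _) => apply: comput_double
  | |- comput _ (fun v => S _) => apply: comput_succn
  | H : comput 1 (fun _ => ?R _)
    |- comput _ (fun v => ?R _) => apply: (comput_comp1 H)
  | H : comput 2 (fun _ => nat_of_bool (?R _ _))
    |- comput _ (fun v => nat_of_bool (?R _ _)) =>
      apply: (comput_comp2 (h := fun x y => nat_of_bool (R x y)) H)
  end.

(** * Pairs and canonical indices *)

Lemma leq_npair x y : x + y <= npair x y.
Proof.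
rewrite /npair; set n := x + y.
have : n.*2 <= n * n.+1 by rewrite mulnS -muln2; nia.
by move/half_leq; rewrite doubleK; lia.
Qed.

(** Makes decoding a pair a bounded search with [exb]. *)
Lemma npair_bound x y : x < (npair x y).+1 /\ y < (npair x y).+1.
Proof. by have := leq_npair x y; lia. Qed.

(** Pairs with sum s occupy a block starting at the s-th triangular number; blocks of distinct sums
    are disjoint, and the offset in a block is the second component. *)
Lemma npair_inj x y x' y' : npair x y = npair x' y' -> x = x' /\ y = y'.
Proof.
have tri n : (n.+1 * n.+2)./2 = (n * n.+1)./2 + n.+1.
  by rewrite mulnC -addn2 mulnDl mulnC [2 * _]mul2n halfD doubleK odd_double andbF.
have tri_mono m n : m <= n -> (m * m.+1)./2 <= (n * n.+1)./2.
  by move=> mn; apply/half_leq/leq_mul.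
have lt_npair a b c d : a + b < c + d -> npair a b < npair c d.
  by move=> /tri_mono; rewrite tri /npair; lia.
move=> E; have [lt|lt|] := ltngtP (x + y) (x' + y').
- by have := lt_npair _ _ _ _ lt; rewrite E ltnn.
- by have := lt_npair _ _ _ _ lt; rewrite E ltnn.
- by move=> s; move: E; rewrite /npair s; lia.
Qed.

(** If [u <= y] then [u < 2 ^ y], so bit y of u is 0. Quantifiers over a canonical finite set are
    thereby bounded by its index. *)
Lemma canonb_lt u y : canonb u y -> y < u.
Proof.
rewrite /canonb ltnNge; apply: contraL => uy.
by rewrite divn_small// (leq_ltn_trans uy)// ltn_expl.
Qed.

Lemma canon_pow2 m : canon (2 ^ m) = [set m].
Proof.
apply/seteqP; split => [y /=|y -> /=]; rewrite /canon /=; last first.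
  by rewrite divnn expn_gt0.
case: (ltngtP y m) => // ym; last by rewrite divn_small// ltn_exp2l.
by rewrite -expnB// ?(ltnW ym)// oddX subn_eq0 leqNgt ym.
Qed.

(** Bits are set one at a time: [P 0] is the lowest, and the rest is twice an index for the shifted
    predicate. *)
Lemma canon_surj n (P : nat -> bool) :
  exists u, forall y, canonb u y = (y < n) && P y.
Proof.
elim: n P => [|n IHn] P; first by exists 0 => y; rewrite /canonb div0n.
have [u uE] := IHn (fun y => P y.+1); exists (P 0 + u.*2) => -[|y].
  by rewrite /canonb expn0 divn1 oddD odd_double oddb addbF.
rewrite /canonb expnS divnMA divn2 halfD doubleK odd_double andbF add0n.
by case: (P 0); rewrite add0n -/(canonb u y) uE.
Qed.

Lemma canonU u w : exists e, canon e = canon u `|` canon w.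
Proof.
have [e eE] := canon_surj (u + w) (fun y => canonb u y || canonb w y).
exists e; apply/seteqP; split => y; rewrite /canon /= -/(canonb e y) eE.
  by case/andP => _ /orP.
move=> /orP H; apply/andP; split => //.
by case/orP: H => /canonb_lt; lia.
Qed.

(** * Computably enumerable sets *)

(** Stage t outputs x if t codes a pair of x and a witness s for x, and otherwise a fixed element c
    of the set, if there is one. *)
Lemma ce_proj (R : nat -> nat -> bool) :
  comput 2 (fun v => R (nth 0 v 0) (nth 0 v 1)) ->
  ce [set x | exists s, R x s].
Proof.
move=> cR; set W := [set x | _].
have [[c [sc Rc]]|W0] := pselect (W !=set0); last first.
  by left; apply/seteqP; split => // x Wx; apply: W0; exists x.
right.
pose hit t x := exb t.+1 (fun s => (npair x s == t) && R x s).
(* The loop tries every x up to t, which suffices because x is at most [npair x s]. *)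
pose f t := nat_rect (fun=> nat) c (fun x r => if hit t x then x else r) t.+1.
have hitP t x : hit t x -> exists2 s, npair x s = t & R x s.
  by case/exbP => s _ /andP[/eqP]; exists s.
exists f.
  have [p pE] : comput 1 (fun v => f (nth 0 v 0)).
    apply: (comput_rec (S := fun x r v => if hit (nth 0 v 0) x then x else r)).
    - by comput_tac.
    - exact: comput_const.
    - by apply: comput_if; rewrite /hit; comput_tac.
  by exists p => x y; rewrite pE.
apply/seteqP; split => [x [s Rxs]|_ [t _ <-]].
  exists (npair x s) => //; rewrite /f.
  have : x < (npair x s).+1 by have [] := npair_bound x s.
  (* Running the loop past x keeps the output x, since a code has only one first component. *)
  elim: (npair x s).+1 => // n IHn; rewrite ltnS leq_eqVlt => /orP[/eqP xn|/IHn IH] /=.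
    case: ifP => // /negP[]; apply/exbP; exists s; last by rewrite -xn eqxx.
    by have [] := npair_bound x s.
  case: ifP => // /hitP[s' /npair_inj[]//].
rewrite /f; elim: t.+1 => [|n IHn] /=; first by exists sc.
by case: ifP => // /hitP[s _ ?]; exists s.
Qed.

Lemma ceP (W : set nat) : ce W ->
  exists2 R : nat -> nat -> bool,
    comput 2 (fun v => R (nth 0 v 0) (nth 0 v 1)) &
    forall x, W x <-> exists s, R x s.
Proof.
case=> [->|[f [c cE] ->]].
  exists (fun _ _ => false); first exact: comput_const.
  by move=> x; split => // -[].
have cf : comput 1 (fun v => f (nth 0 v 0)).
  exists c => v y; rewrite -cE.
  suff -> : v = [tuple nth 0 v 0] by [].
  apply/val_inj; case: v => -[|a [|]]//.
exists (fun x s => f s == x); first by comput_tac.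
move=> x; split => [[s _ <-]|[s /eqP<-]]; first by exists s.
by exists s.
Qed.

(** * Enumeration reducibility *)

(** Many-one reducibility is a special case: the axioms pair x with the singleton of [h x], whose
    canonical index is [2 ^ h x]. *)
Lemma ele_preimage (h : nat -> nat) (A B : set nat) :
  comput 1 (fun v => h (nth 0 v 0)) -> (forall x, A x <-> B (h x)) -> ele A B.
Proof.
move=> ch AB.
exists [set p | exists x, p == npair x (2 ^ h x)].
  by apply: ce_proj; comput_tac.
apply/seteqP; split => x.
  move=> /AB Bhx; exists (2 ^ h x); first by exists x.
  by rewrite canon_pow2 => _ ->.
case=> u [x' /eqP/npair_inj[<- ->]].
by rewrite canon_pow2 => hB; apply/AB/hB.
Qed.

Lemma ele_refl A : ele A A.
Proof. by apply: (@ele_preimage id) => //; comput_tac. Qed.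

Lemma ele_joinl X Y : ele X (ejoin X Y).
Proof.
apply: (@ele_preimage double); first by comput_tac.
move=> x; split => [Xx|]; first by left; exists x.
by case=> -[y ? E]; [have <- : y = x by lia | lia].
Qed.

Lemma ele_joinr X Y : ele Y (ejoin X Y).
Proof.
apply: (@ele_preimage (fun x => x.*2.+1)); first by comput_tac.
move=> x; split => [Xx|]; first by right; exists x.
by case=> -[y ? E]; [lia | have <- : y = x by lia].
Qed.

(** Each axiom <y, u> of the first operator becomes <2y, u>, and each axiom <y, u> of the second
    becomes <2y+1, u>. *)
Lemma ele_join X Y Z : ele X Z -> ele Y Z -> ele (ejoin X Y) Z.
Proof.
move=> [G /ceP[R cR RE] ->] [D /ceP[Q cQ QE] ->].
pose half_axiom x y u s := ((x == y.*2) && R (npair y u) s) ||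
                           ((x == y.*2.+1) && Q (npair y u) s).
(* The search for y stops at x, since 2y and 2y+1 are at least y. *)
pose T p s := exb p.+1 (fun x => exb p.+1 (fun u =>
  (p == npair x u) && exb x.+1 (fun y => half_axiom x y u s))).
exists [set p | exists s, T p s].
  by apply: ce_proj; rewrite /T /half_axiom; comput_tac.
apply/seteqP; split => x.
  have intro y u s : y <= x -> half_axiom x y u s -> canon u `<=` Z ->
      enum_op [set p | exists s, T p s] Z x.
    move=> yx H uZ; exists u => //; exists s.
    have [xp up] := npair_bound x u.
    apply/exbP; exists x => //; apply/exbP; exists u => //.
    by rewrite eqxx; apply/exbP; exists y.
  case=> -[y [u /= axy uZ] yx].
    have [s Rs] := (RE _).1 axy; apply: (intro y u s) => //; first by lia.
    by rewrite /half_axiom yx eqxx Rs.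
  have [s Qs] := (QE _).1 axy; apply: (intro y u s) => //; first by lia.
  by rewrite /half_axiom yx eqxx Qs orbT.
case=> u [s /exbP[x' _ /exbP[u' _ /andP[/eqP/npair_inj[<- <-]]]]].
case/exbP => y _ /orP[] /andP[/eqP-> H] uZ; [left|right]; exists y => //;
  exists u => //; first by apply/RE; exists s.
by apply/QE; exists s.
Qed.

(* An axiom <x, E> of the composite operator is confirmed at stage [s] if some
   axiom <x, D> of the outer operator has each element of D enumerated by an
   axiom <y, u> of the inner one with u included in E; asking for inclusion
   rather than for E to be the union of the sets u needs no sequence coding. *)
Lemma ele_trans A B C : ele A B -> ele B C -> ele A C.
Proof.
move=> [G /ceP[R cR RE] ->] [H /ceP[Q cQ QE] ->].
pose inner s y e := exb s (fun i => exb s (fun u =>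
  Q (npair y u) i && allb u (fun z => canonb u z ==> canonb e z))).
pose T p s := exb p.+1 (fun x => exb p.+1 (fun e => (p == npair x e) &&
  exb s (fun d => exb s (fun a => R (npair x d) a &&
    allb d (fun y => canonb d y ==> inner s y e))))).
have innerP s y e : inner s y e ->
    exists u, H (npair y u) /\ canon u `<=` canon e.
  case/exbP => i _ /exbP[u _ /andP[Qu /allbP ue]]; exists u; split.
    by apply/QE; exists i.
  by move=> z uz; apply: (implyP (ue z _)) => //; apply: canonb_lt.
(* Monotonicity lets witnesses found separately for the elements of D be merged into one finite set
   and one stage. *)
have inner_mono s y e s' e' : s <= s' -> canon e `<=` canon e' ->
    inner s y e -> inner s' y e'.
  move=> ss' ee' /exbP[i ls /exbP[u us /andP[Qu /allbP ue]]].
  apply/exbP; exists i; first exact: leq_trans ss'.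
  apply/exbP; exists u; first exact: leq_trans ss'.
  rewrite Qu; apply/allbP => z zu; apply/implyP => uz.
  by apply: ee'; apply: (implyP (ue z zu)).
exists [set p | exists s, T p s].
  by apply: ce_proj; rewrite /T /inner; comput_tac.
apply/seteqP; split => x.
  case=> d Gd dB.
  have [e [s [eC es]]] : exists e s, canon e `<=` C /\
      forall y, y < d -> canonb d y -> inner s y e.
    (* Elements of [canon d] are treated in increasing order: [e] collects the finite sets used so
       far, and [s] exceeds their indices and witnesses. *)
    elim: {1}d => [|n [e [s [eC es]]]].
      by exists 0, 0; split => // y; rewrite /canon /= div0n.
    have [dn|dn] := boolP (canonb d n); last first.
      exists e, s; split => // y; rewrite ltnS leq_eqVlt => /orP[/eqP->|].
        by rewrite (negbTE dn).
      exact: es.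
    have [u Hu uC] := dB n dn; have [i Qi] := (QE _).1 Hu.
    have [e' e'E] := canonU e u.
    exists e', (s + i.+1 + u.+1); split.
      by rewrite e'E => z [/eC|/uC].
    move=> y; rewrite ltnS leq_eqVlt => /orP[/eqP-> _|yn dy].
      apply/exbP; exists i; first by lia.
      apply/exbP; exists u; first by lia.
      rewrite Qi; apply/allbP => z zu; apply/implyP => uz.
      by have : canon e' z by rewrite e'E; right.
    apply: inner_mono (es y yn dy); first by lia.
    by rewrite e'E => z; left.
  have [a Ra] := (RE _).1 Gd.
  exists e => //; exists (s + d.+1 + a.+1).
  have [xp ep] := npair_bound x e.
  apply/exbP; exists x => //; apply/exbP; exists e => //; rewrite eqxx /=.
  apply/exbP; exists d; first by lia.
  apply/exbP; exists a; first by lia.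
  rewrite Ra; apply/allbP => y yd; apply/implyP => dy.
  by apply: inner_mono (es y yd dy) => //; lia.
case=> e [s /exbP[x' _ /exbP[e' _ /andP[/eqP/npair_inj[<- <-]]]]].
case/exbP => d _ /exbP[a _ /andP[Ra /allbP dI]] eC.
exists d; first by apply/RE; exists a.
move=> y dy; have /innerP[u [Hu ue]] := implyP (dI y (canonb_lt dy)) dy.
by exists u => // z /ue /eC.
Qed.

(** * Coverings by ideals *)

Lemma elt_le A B C : ele A B -> elt B C -> elt A C.
Proof.
move=> AB [BC nCB]; split; first exact: ele_trans BC.
by move=> CA; apply: nCB; apply: ele_trans AB.
Qed.

Lemma ejoin_le X Y X' Y' :
  ele X X' -> ele Y Y' -> ele (ejoin X Y) (ejoin X' Y').
Proof.
move=> XX' YY'; apply: ele_join.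
  exact: ele_trans XX' (ele_joinl _ _).
exact: ele_trans YY' (ele_joinr _ _).
Qed.

Lemma ejoinC_le X Y : ele (ejoin X Y) (ejoin Y X).
Proof. by apply: ele_join; [exact: ele_joinr | exact: ele_joinl]. Qed.

Lemma eideal_joinP J X Y : eideal J -> (J (ejoin X Y) <-> J X /\ J Y).
Proof.
move=> [_ Jle Jjoin]; split => [JXY|[]]; last exact: Jjoin.
by split; apply: Jle JXY; [exact: ele_joinl | exact: ele_joinr].
Qed.

Lemma covering_elt n A (F : 'I_n -> set (set nat)) Z :
  covering (ebelow A) F -> (elt Z A <-> exists i, F i Z).
Proof.
move=> [_ FA]; rewrite -[elt Z A]/(ebelow A Z) -FA; split => [[i _ FZ]|[i FZ]].
  by exists i.
by exists i.
Qed.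

Lemma proper_covering_witness n A (F : 'I_n -> set (set nat)) :
  proper_covering (ebelow A) F ->
  exists X : 'I_n -> set nat, forall i j, F j (X i) <-> j = i.
Proof.
move=> [[Fid _] Fprop].
suff /choice[X XE] : forall i, exists X, forall j, F j X <-> j = i by exists X.
move=> i.
have [X [FX nFX]] : exists X, F i X /\
    forall j, j \in enum 'I_n -> j != i -> ~ F j X.
  (* Induction on the indices already avoided: joining X with an element of F_i outside F_j avoids
     F_j, and by downward closure the earlier ideals stay avoided. *)
  elim: (enum 'I_n) => [|j s [X [FX nFX]]].
    by have [[X FX] _ _] := Fid i; exists X.
  have [->|ji] := eqVneq j i.
    exists X; split => // k; rewrite inE => /orP[->//|ks].
    exact: nFX.
  have [Y FY nFY] : exists2 Y, F i Y & ~ F j Y.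
    rewrite eq_sym in ji; apply: contra_notP (Fprop _ _ ji) => noY Y FY.
    by apply: contra_notP noY => nFY; exists Y.
  exists (ejoin X Y); split; first exact/(eideal_joinP _ _ (Fid i)).
  move=> k; rewrite inE => /orP[/eqP->|ks] ki /(eideal_joinP _ _ (Fid _))[].
    by [].
  by move=> FkX _; apply: (nFX k).
exists X => j; split => [FjX|->//]; apply: contraPP FjX => /eqP ji.
by apply: nFX => //; rewrite mem_enum.
Qed.

(* A member of exactly one ideal of a covering determines that ideal; hence
   uniqueness of proper coverings. *)
Lemma covering_witness_ideal n A (F : 'I_n -> set (set nat)) i X :
  covering (ebelow A) F -> (forall j, F j X <-> j = i) ->
  F i = [set Z | elt (ejoin Z X) A].
Proof.
move=> cF XE; have [Fid _] := cF; apply/seteqP; split => Z /=.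
  move=> FZ; apply/(covering_elt _ cF); exists i.
  by apply/(eideal_joinP _ _ (Fid i)); split => //; apply/XE.
move=> /(covering_elt _ cF)[j /(eideal_joinP _ _ (Fid j))[FZ /XE ji]].
by rewrite -ji.
Qed.

Lemma proper_covering_unique n A (F G : 'I_n -> set (set nat)) :
  proper_covering (ebelow A) F -> proper_covering (ebelow A) G ->
  exists s : {perm 'I_n}, forall i, G i = F (s i).
Proof.
move=> pF pG; have [cF _] := pF; have [cG _] := pG.
have [Fid _] := cF; have [Gid _] := cG.
have [X XE] := proper_covering_witness pG.
have Xjoin i j : elt (ejoin (X i) (X j)) A -> i = j.
  move=> /(covering_elt _ cG)[k /(eideal_joinP _ _ (Gid k))[]].
  by move=> /XE <- /XE.
have /choice[s sE] : forall i, exists j, F j (X i).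
  move=> i; apply/(covering_elt _ cF)/(covering_elt _ cG).
  by exists i; apply/XE.
(* Two witnesses in one ideal of F have their join below A, hence in some ideal of G, which forces
   equal indices. *)
have same i j k : F k (X i) -> F k (X j) -> i = j.
  move=> Fi Fj; apply/Xjoin/(covering_elt _ cF); exists k.
  exact/(eideal_joinP _ _ (Fid k)).
have sinj : injective s.
  by move=> i j sij; apply: (same i j (s i)); rewrite // sij.
exists (perm sinj) => i; rewrite permE.
rewrite (covering_witness_ideal cG (XE i)).
(* X_i lies in no ideal of F but the one of index [s i]: an injection of 'I_n into itself is onto,
   so any index is [s k], and that ideal already contains X_k. *)
rewrite -(@covering_witness_ideal _ _ F (s i))// => j.
split => [FX|->//]; have [k sk] : exists k, s k = j.
  by exists (invF sinj j); rewrite f_invF.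
by rewrite -sk; congr s; apply: (same k i j) => //; rewrite -sk.
Qed.

Lemma covering_join_irreducible n A (F : 'I_n -> set (set nat)) :
  covering (ebelow A) F -> join_irreducible n A.
Proof.
move=> cF B BA.
have /choice[s sE] : forall i, exists j, F j (B i).
  by move=> i; apply/(covering_elt _ cF).
have [/injectiveP sinj|/injectivePn[i [j ij sij]]] := boolP (injectiveb s).
  by have := leq_card _ sinj; rewrite !card_ord ltnn.
exists i, j; split => //; apply/(covering_elt _ cF); exists (s i).
have [Fid _] := cF.
by apply/(eideal_joinP _ _ (Fid _)); split; rewrite ?sij; [rewrite -sij|].
Qed.

Lemma proper_covering_join_reducible n A (F : 'I_n.+1 -> set (set nat)) :
  proper_covering (ebelow A) F -> join_reducible n A.
Proof.
move=> pF; have [cF _] := pF; have [Fid _] := cF.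
have [X XE] := proper_covering_witness pF.
move=> /(_ X)[i|i [j [ij /(covering_elt _ cF)[k]]]].
  by apply/(covering_elt _ cF); exists i; apply/XE.
move=> /(eideal_joinP _ _ (Fid k))[/XE ki /XE kj].
by case/eqP: ij; rewrite -ki.
Qed.

(** Joins of sets below A are reducible to A, so a join that is not strictly below A has the degree
    of A. *)
Lemma join_reducibleP n A : join_reducible n A ->
  exists2 B : 'I_n.+1 -> set nat, forall i, elt (B i) A &
    forall i j, elt (ejoin (B i) (B j)) A -> i = j.
Proof.
move=> /existsNP[B /not_implyP[BA nB]]; exists B => // i j ijA.
by apply: contra_notP nB => /eqP ij; exists i, j.
Qed.

Lemma join_reducible_covering n A :
  join_irreducible n.+1 A -> join_reducible n A ->
  exists F : 'I_n.+1 -> set (set nat), proper_covering (ebelow A) F.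
Proof.
move=> irr /join_reducibleP[B BA Bjoin].
exists (fun i => [set Z | elt (ejoin Z (B i)) A]).
have BiB i : elt (ejoin (B i) (B i)) A.
  by apply: elt_le (BA i); apply: ele_join; exact: ele_refl.
(* B_i lies in its own ideal, and in the j-th one only if B_i + B_j < A, that is, if i = j. *)
split; last by move=> i j /eqP ij /(_ (B i) (BiB i)) /Bjoin.
split; last first.
  apply/seteqP; split => [Z [i _]|Z ZA]; first by apply: elt_le (ele_joinl _ _).
  (* The family is Z at [ord0] followed by the B_i; a pair of entries with join below A must involve
     Z. *)
  have [|i [j []]] := irr (fun i => oapp B Z (unlift ord0 i)).
    by move=> i; case: unliftP => [j _|_]; [exact: BA | exact: ZA].
  case: unliftP => [i' ->|->]; case: unliftP => [j' ->|->] //= neq ijA.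
  - by rewrite (Bjoin _ _ ijA) eqxx in neq.
  - by exists i' => //; apply: elt_le ijA; apply: ejoinC_le.
  - by exists j'.
move=> i; split; first by exists (B i); exact: BiB.
  by move=> X Y XY; apply: elt_le; apply: ejoin_le => //; exact: ele_refl.
move=> X Y XA YA /=.
(* The entry at [ord0] bounds B_i and the k-th of the others bounds B_k, so the only pair that can
   join below A is Y + B_i and X + B_i. *)
have [|a [b []]] := irr (fun k => oapp (fun k =>
    if k == i then ejoin X (B i) else B k) (ejoin Y (B i)) (unlift ord0 k)).
  by move=> k; case: unliftP => [j _|_] /=; [case: eqP => _ | exact: YA].
have Bjoin_le p q U V : ele (B p) U -> ele (B q) V ->
    elt (ejoin U V) A -> p = q.
  by move=> pU qV UVA; apply: Bjoin; apply: elt_le UVA; apply: ejoin_le.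
have Ble k : ele (B k) (if k == i then ejoin X (B i) else B k).
  by case: eqP => [->|_]; [exact: ele_joinr | exact: ele_refl].
have XYi : elt (ejoin (ejoin X (B i)) (ejoin Y (B i))) A ->
    elt (ejoin (ejoin X Y) (B i)) A.
  apply: elt_le; apply: ele_join.
    by apply: ejoin_le; exact: ele_joinl.
  exact: ele_trans (ele_joinr _ _) (ele_joinl _ _).
case: unliftP => [a' ->|->]; case: unliftP => [b' ->|->] //= neq abA.
- by rewrite (Bjoin_le _ _ _ _ (Ble _) (Ble _) abA) eqxx in neq.
- move: (abA); rewrite (Bjoin_le _ _ _ _ (Ble _) (ele_joinr _ _) abA) eqxx.
  exact: XYi.
- move: (abA); rewrite -(Bjoin_le _ _ _ _ (ele_joinr _ _) (Ble _) abA) eqxx.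
  by move=> YXi; apply: XYi; apply: elt_le YXi; exact: ejoinC_le.
Qed.

Theorem theorem4p8 (n : nat) (hn : 1 <= n) (A : set nat) :
  ((exists F : 'I_n -> set (set nat),
      proper_covering (ebelow A) F /\
      forall G : 'I_n -> set (set nat), proper_covering (ebelow A) G ->
        exists s : {perm 'I_n}, forall i, G i = F (s i))
   <-> (exists F : 'I_n -> set (set nat), proper_covering (ebelow A) F))
  /\
  ((exists F : 'I_n -> set (set nat), proper_covering (ebelow A) F)
   <-> (join_irreducible n A /\ join_reducible n.-1 A)).
Proof.
case: n hn => [//|n _]; split; split.
- by move=> [F [pF _]]; exists F.
- by move=> [F pF]; exists F; split => // G; exact: proper_covering_unique.
- move=> [F pF]; split; last exact: proper_covering_join_reducible pF.
  by have [cF _] := pF; exact: covering_join_irreducible cF.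
- by move=> [irr red]; exact: join_reducible_covering.
Qed.
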